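(* Let $\mathcal{Q}$ be a collection of finite automata and let $\mathcal{G}$ be the collection of finite simple groups that divide the monoid $M(\mathbf{Q})$ of some automaton $\mathbf{Q}\in\mathcal{Q}$. Then a Conway category satisfies the identities $\Gamma(\mathbf{Q})$ for all $\mathbf{Q}\in\mathcal{Q}$ if and only if it satisfies the group identities $\Gamma(G)$ for all $G\in\mathcal{G}$.
   Context: Cartesian categories have chosen finite products (terminal object $T$, projections $\pi_i$, tupling $\langle\cdot\rangle$, $!_A:A\to T$, $f\times g$), strictly associative; composition is written $g\circ f$; $\Delta_{A^n}=\langle 1_A,\ldots,1_A\rangle:A\to A^n$. A dagger operation maps $f:A\times C\to A$ to $f^\dagger:C\to A$. A Conway category is a cartesian category with dagger satisfying: $(f\circ(1_A\times g))^\dagger=f^\dagger\circ g$ ($f:A\times B\to A$, $g:C\to B$); $f^{\dagger\dagger}=(f\circ(\Delta_{A^2}\times 1_C))^\dagger$ ($f:A\times A\times C\to A$); $(f\circ\langle g,\pi_2^{A\times C}\rangle)^\dagger=f\circ\langle (g\circ\langle f,\pi_2^{B\times C}\rangle)^\dagger,1_C\rangle$ ($f:B\times C\to A$, $g:A\times C\to B$). A finite automaton $\mathbf{Q}=(Q,Z,\cdot)$ has finite nonempty state set $Q$, finite nonempty input alphabet $Z$ and action $Q\times Z\to Q$, extended to words; $M(\mathbf{Q})$ is the monoid of functions $Q\to Q$, $q\mapsto qu$, induced by words $u\in Z^*$. Write $Q=\{q_1,\ldots,q_n\}$, identified with $\{1,\ldots,n\}$, and $Z=\{a_1,\ldots,a_m\}$.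 For an object $A$ and $i\in[n]$ let $\rho_i^{\mathbf{Q},A}=\langle\pi^{A^n}_{ia_1},\ldots,\pi^{A^n}_{ia_m}\rangle:A^n\to A^m$ ($ia_j$ is the index of $q_i\cdot a_j$). For $f:A^m\times C\to A$ let $f^{\mathbf{Q},A}:A^n\times C\to A^n$ have components $\pi_i^{A^n}\circ f^{\mathbf{Q},A}=f\circ(\rho_i^{\mathbf{Q},A}\times 1_C)$. The identity $\Gamma(\mathbf{Q})$ holds in $\mathcal{C}$ if $(f^{\mathbf{Q},A})^\dagger=\Delta_{A^n}\circ(f\circ(\Delta_{A^m}\times 1_C))^\dagger$ for all objects $A,C$ and all $f:A^m\times C\to A$. For a finite group $G$, $\Gamma(G)$ is $\Gamma$ of the automaton $(G,G,\cdot)$ with action by multiplication. A group in a finite monoid $M$ is a subsemigroup of $M$ which is a group; a finite group divides $M$ if it is a homomorphic image of a group in $M$. A finite group is simple if it is nontrivial and has no normal subgroups other than itself and the trivial one. *)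

(* Defs.v *)
From mathcomp Require Import all_boot all_fingroup all_solvable.
Set Implicit Arguments. Unset Strict Implicit. Unset Printing Implicit Defensive.

Unset Implicit Arguments.
Record cartCat := CartCat {
  ob : Type;
  hom : ob -> ob -> Type;
  idm : forall A, hom A A;
  comp : forall A B D, hom B D -> hom A B -> hom A D;
  compA : forall A B D E (h : hom D E) (g : hom B D) (f : hom A B),
      comp A D E h (comp A B D g f) = comp A B E (comp B D E h g) f;
  comp1m : forall A B (f : hom A B), comp A B B (idm B) f = f;
  compm1 : forall A B (f : hom A B), comp A A B f (idm A) = f;
  term : ob;
  bang : forall A, hom A term;
  bang_uniq : forall A (f : hom A term), f = bang A;
  prod : ob -> ob -> ob;
  pi1 : forall A B, hom (prod A B) A;
  pi2 : forall A B, hom (prod A B) B;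
  pair : forall D A B, hom D A -> hom D B -> hom D (prod A B);
  pi1_pair : forall D A B (f : hom D A) (g : hom D B),
      comp D (prod A B) A (pi1 A B) (pair D A B f g) = f;
  pi2_pair : forall D A B (f : hom D A) (g : hom D B),
      comp D (prod A B) B (pi2 A B) (pair D A B f g) = g;
  pair_uniq : forall D A B (h : hom D (prod A B)),
      pair D A B (comp D (prod A B) A (pi1 A B) h)
                 (comp D (prod A B) B (pi2 A B) h) = h
}.

Set Implicit Arguments.
Arguments hom {c}.
Arguments idm {c}.
Arguments comp {c A B D}.
Arguments term {c}.
Arguments bang {c}.
Arguments prod {c}.
Arguments pi1 {c}.
Arguments pi2 {c}.
Arguments pair {c D A B}.

Section Derived.
Variable c : cartCat.

Definition mprod (A B A' B' : ob c) (f : hom A A') (g : hom B B') :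
  hom (prod A B) (prod A' B') :=
  pair (comp f (pi1 A B)) (comp g (pi2 A B)).

Fixpoint pw (A : ob c) (n : nat) : ob c :=
  match n with 0 => term | n'.+1 => prod A (pw A n') end.

Lemma ord0_false : 'I_0 -> False.
Proof. by case. Qed.

Fixpoint prj (A : ob c) (n : nat) : 'I_n -> hom (pw A n) A :=
  match n return 'I_n -> hom (pw A n) A with
  | 0 => fun i => False_rect _ (ord0_false i)
  | n'.+1 => fun i => match unlift ord0 i with
                      | None => pi1 A (pw A n')
                      | Some j => comp (@prj A n' j) (pi2 A (pw A n'))
                      end
  end.

Fixpoint tup (X A : ob c) (n : nat) : ('I_n -> hom X A) -> hom X (pw A n) :=
  match n return ('I_n -> hom X A) -> hom X (pw A n) with
  | 0 => fun _ => bang X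
  | n'.+1 => fun fs => pair (fs ord0) (tup (fun j => fs (lift ord0 j)))
  end.

Definition diag (A : ob c) (n : nat) : hom A (pw A n) := tup (fun _ : 'I_n => idm A).

End Derived.

Unset Implicit Arguments.
Record conwayCat := ConwayCat {
  cc :> cartCat;
  dag : forall (A D : ob cc), hom (prod A D) A -> hom D A;
  dag_param : forall (A B D : ob cc) (f : hom (prod A B) A) (g : hom D B),
      dag A D (comp f (mprod (idm A) g)) = comp (dag A B f) g;
  dag_dag : forall (A D : ob cc) (f : hom (prod A (prod A D)) A),
      dag A D (dag A (prod A D) f)
      = dag A D (comp f (pair (pi1 A D) (pair (pi1 A D) (pi2 A D))));
  dag_comp : forall (A B D : ob cc) (f : hom (prod B D) A) (g : hom (prod A D) B),
      dag A D (comp f (pair g (pi2 A D)))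
      = comp f (pair (dag B D (comp g (pair f (pi2 B D)))) (idm D))
}.

Set Implicit Arguments.
Arguments dag {c A D}.

Record automaton := Automaton {
  nst : nat;
  nin : nat;
  nst_gt0 : 0 < nst;
  nin_gt0 : 0 < nin;
  act : 'I_nst -> 'I_nin -> 'I_nst
}.

Notation trans Q := {ffun 'I_(nst Q) -> 'I_(nst Q)}.

Definition act_word (Q : automaton) (q : 'I_(nst Q)) (u : seq 'I_(nin Q)) : 'I_(nst Q) :=
  foldl (@act Q) q u.

Definition inM (Q : automaton) (f : trans Q) : Prop :=
  exists u : seq 'I_(nin Q), forall q, f q = act_word q u.

Definition tmul (Q : automaton) (f g : trans Q) : trans Q := [ffun q => g (f q)].

Definition group_in (Q : automaton) (S : {set trans Q}) : Prop :=
  [/\ (forall s, s \in S -> inM s),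
      (forall s t, s \in S -> t \in S -> tmul s t \in S) &
      exists2 e, e \in S &
        (forall s, s \in S -> tmul e s = s /\ tmul s e = s) /\
        (forall s, s \in S -> exists2 t, t \in S & tmul s t = e /\ tmul t s = e)].

Definition divides (gT : finGroupType) (G : {group gT}) (Q : automaton) : Prop :=
  exists S : {set trans Q}, group_in S /\
    exists phi : trans Q -> gT,
      [/\ (forall s, s \in S -> phi s \in G),
          (forall s t, s \in S -> t \in S -> phi (tmul s t) = (phi s * phi t)%g) &
          (forall x, x \in G -> exists2 s, s \in S & phi s = x)].

Definition grpAut (gT : finGroupType) (G : {group gT}) : automaton :=
  @Automaton #|G| #|G| (cardG_gt0 G) (cardG_gt0 G)
    (fun i j => enum_rank_in (group1 G) (enum_val i * enum_val j)%g).

Definition rho (c : cartCat) (Q : automaton) (A : ob c) (i : 'I_(nst Q)) :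
  hom (pw A (nst Q)) (pw A (nin Q)) :=
  tup (fun j => prj A (@act Q i j)).

Definition fQ (c : cartCat) (Q : automaton) (A D : ob c)
  (f : hom (prod (pw A (nin Q)) D) A) : hom (prod (pw A (nst Q)) D) (pw A (nst Q)) :=
  tup (fun i => comp f (mprod (@rho c Q A i) (idm D))).

Definition Gamma (c : conwayCat) (Q : automaton) : Prop :=
  forall (A D : ob c) (f : hom (prod (pw A (nin Q)) D) A),
    dag (fQ f) = comp (diag A (nst Q)) (dag (comp f (mprod (diag A (nin Q)) (idm D)))).

(* Main.v *)
From mathcomp Require Import all_boot all_fingroup all_solvable.
From mathcomp Require Import boolp.
Require Import Defs.
Set Implicit Arguments. Unset Strict Implicit. Unset Printing Implicit Defensive.

(** For fixed objects [A] and [D], the morphisms [A^I x D -> A] are the terms in variables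
    [I] of an algebraic theory with substitution and with solutions of finite systems of
    equations, and the identity [Gamma(Q)], used at all powers of [A], becomes a statement
    about this theory. In this form it passes to subautomata, to homomorphic images, to
    words as letters and to cascade products.

    A group [G] dividing [M(Q)] is an image of a subautomaton of a power of [Q] whose letters
    are words, so [Gamma(Q)] implies [Gamma(G)]. Conversely [Gamma(Q)] is derived by
    induction on the number of states and then of letters. If all letters are permutations,
    then [Q] is a union of images of the regular automaton of a group, which is a cascade of
    a normal subgroup and its quotient. Otherwise let [c] be a letter that is not injective,
    [B] the other letters and [N] the monoid generated by [B]. Solving first for the letters
    in [B], with the values at the states in [Qc] as parameters, leaves a system over the
    automaton with states [Qc] and letters [nc], for [n] in [N], which has fewer states (the
    local divisor argument for the Krohn-Rhodes theorem). *)

(** * Systems of equations in a Conway theory *)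

Definition sumcase (X Y R : Type) (f : X -> R) (g : Y -> R) (s : X + Y) : R :=
  match s with inl x => f x | inr y => g y end.

(** In [tm (I + K)] the summand [I] holds the unknowns and [K] the parameters. The last three laws
    are the parameter, double dagger and composition identities, for systems indexed by arbitrary
    finite types so that unknowns can be regrouped without index arithmetic. *)
Record conwayTheory := ConwayTheory {
  tm : finType -> Type;
  var : forall I : finType, I -> tm I;
  bind : forall I J : finType, tm I -> (I -> tm J) -> tm J;
  bindA : forall (I J K : finType) (t : tm I) (s : I -> tm J) (r : J -> tm K),
      bind (bind t s) r = bind t (fun i => bind (s i) r);
  bindv : forall (I J : finType) (i : I) (s : I -> tm J), bind (var i) s = s i;
  bind_var : forall (I : finType) (t : tm I), bind t (@var I) = t;
  sol : forall I K : finType, (I -> tm (I + K)%type) -> I -> tm K;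
  sol_nat : forall (I K K' : finType) (F : I -> tm (I + K)%type) (s : K -> tm K') i,
      bind (sol F i) s
      = sol (fun i => bind (F i) (sumcase (fun i => var (inl i : I + K'))
                         (fun k => bind (s k) (fun k => var (inr k : I + K'))))) i;
  sol_sol : forall (I K : finType) (F : I -> tm (I + (I + K))%type) i,
      sol (sol F) i = sol (fun i => bind (F i) (sumcase (fun i => var (inl i : I + K))
                                                        (@var (I + K)%type))) i;
  sol_comp : forall (I J K : finType) (F : I -> tm (J + K)%type) (G : J -> tm (I + K)%type) i,
      sol (fun i => bind (F i) (sumcase G (fun k => var (inr k : I + K)))) i
      = bind (F i) (sumcase
          (sol (fun j => bind (G j) (sumcase F (fun k => var (inr k : J + K)))))
          (@var K))
}.
Arguments var {c I}.
Arguments bind {c I J}.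
Arguments sol {c I K}.

Section Systems.
Variable Th : conwayTheory.
Implicit Types I J K : finType.

Lemma eq_bind I J (t : tm Th I) (s r : I -> tm Th J) : s =1 r -> bind t s = bind t r.
Proof. by move/funext->. Qed.

Lemma eq_sol I K (F G : I -> tm Th (I + K)%type) : F =1 G -> sol F =1 sol G.
Proof. by move/funext->. Qed.

(** The composition identity with the unknowns themselves as [G]. *)
Lemma sol_fix I K (F : I -> tm Th (I + K)%type) i :
  sol F i = bind (F i) (sumcase (sol F) var).
Proof.
have := sol_comp F (fun i => var (inl i : I + K)) i.
rewrite (@eq_sol _ _ _ F) => [->|{}i].
  apply: eq_bind => -[i'|k] //=; apply: eq_sol => {}i'.
  by rewrite bindv.
by rewrite -[RHS]bind_var; apply: eq_bind => -[].
Qed.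

(* Bekic elimination: [u_i] are solved for first, with the [v_j] as parameters, and
   then [v_j] is identified with [u_(iota j)]. *)
Lemma bekic I J K (iota : J -> I) (F : I -> tm Th (I + K)%type)
    (L : I -> tm Th (I + (J + K))%type) :
  (forall i, F i = bind (L i) (sumcase (fun i => var (inl i))
                  (sumcase (fun j => var (inl (iota j))) (fun k => var (inr k))))) ->
  forall i, sol F i = bind (sol L i) (sumcase (sol (fun j => sol L (iota j))) var).
Proof.
move=> FL i.
pose s : J + K -> tm Th (I + K)%type :=
  sumcase (fun j => var (inl (iota j))) (fun k => var (inr k)).
(* The double dagger identity solves the unknowns kept in [L] inside and those reached through [s]
   outside. Then [sol_nat] pulls [s] out, and [sol_comp] exchanges the outer system over [I] for one
   over [J]. *)
have E : sol F i = sol (sol (fun i => bind (L i) (sumcase (fun i => var (inl i))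
   (fun x => bind (s x) (fun x => var (inr x : I + (I + K))))))) i.
  rewrite sol_sol; apply: eq_sol => i'; rewrite FL bindA; apply: eq_bind.
  by case=> [?|[?|?]] /=; rewrite ?bindv //= !bindv.
rewrite E.
have -> : sol (fun i => bind (L i) (sumcase (fun i => var (inl i))
   (fun x => bind (s x) (fun x => var (inr x : I + (I + K))))))
   = fun i => bind (sol L i) s.
  by apply/funext => i'; rewrite sol_nat.
rewrite sol_comp; apply: eq_bind => -[j|k] //=.
by apply: eq_sol => j'; rewrite bindv.
Qed.

Lemma bekic_iota I J K (iota : J -> I) (F : I -> tm Th (I + K)%type)
    (L : I -> tm Th (I + (J + K))%type) :
  (forall i, F i = bind (L i) (sumcase (fun i => var (inl i))
                  (sumcase (fun j => var (inl (iota j))) (fun k => var (inr k))))) ->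
  forall j, sol F (iota j) = sol (fun j => sol L (iota j)) j.
Proof. by move=> FL j; rewrite (bekic FL) [RHS]sol_fix. Qed.

(** The unknowns in the image of [iota] form a closed subsystem. On the image, the equations of [L]
    contain parameters only, so [L] is solved there by [G] and [bekic_iota] leaves the system
    [G]. *)
Lemma sol_sub I J K (iota : J -> I) (F : I -> tm Th (I + K)%type)
    (G : J -> tm Th (J + K)%type) : injective iota ->
  (forall j, F (iota j)
     = bind (G j) (sumcase (fun j => var (inl (iota j))) (fun k => var (inr k)))) ->
  forall j, sol F (iota j) = sol G j.
Proof.
move=> iotaI FG j.
pose L i : tm Th (I + (J + K))%type :=
  if [pick j | iota j == i] is Some j then bind (G j) (fun x => var (inr x))
  else bind (F i) (sumcase (fun i => var (inl i)) (fun k => var (inr (inr k)))).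
have Li j' : L (iota j') = bind (G j') (fun x => var (inr x)).
  by rewrite /L; case: pickP => [j1 /eqP/iotaI->//|/(_ j')]; rewrite eqxx.
rewrite (@bekic_iota _ _ _ iota F L).
  by apply: eq_sol => j'; rewrite sol_fix Li bindA -[RHS]bind_var; apply: eq_bind => x;
     rewrite bindv.
move=> i; rewrite /L; case: pickP => [j' /eqP <-|_].
  by rewrite FG bindA; apply: eq_bind => -[x|x]; rewrite bindv.
by rewrite bindA -[LHS]bind_var; apply: eq_bind => -[x|x]; rewrite bindv.
Qed.

(** * Systems over an automaton and closure properties of [VGamma] *)

Definition lsys (Q Z J K : finType) (d : Q -> Z -> Q)
    (f : J * Q -> tm Th (J * Z + K)%type) (x : J * Q) : tm Th (J * Q + K)%type :=
  bind (f x) (sumcase (fun y => var (inl (y.1, d x.2 y.2))) (fun k => var (inr k))).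

Definition sys (Q Z J K : finType) (d : Q -> Z -> Q) (f : J -> tm Th (J * Z + K)%type) :=
  lsys d (fun x => f x.1).

Definition act1 (Z : finType) (_ : unit) (_ : Z) := tt.

(* The identity [Gamma(Q)] instantiated at the powers [A^J] of the base object. The
   right-hand side is the same system over the one-state automaton. *)
Definition VGamma (Q Z : finType) (d : Q -> Z -> Q) :=
  forall (J K : finType) (f : J -> tm Th (J * Z + K)%type) j q,
    sol (sys d f) (j, q) = sol (sys (@act1 Z) f) (j, tt).

Lemma VGamma_unit (Z : finType) (d : unit -> Z -> unit) : VGamma d.
Proof.
move=> J K f j []; apply: eq_sol => -[j' x].
by rewrite /sys /lsys; apply: eq_bind => -[y|y] //=; case: (d _ _).
Qed.

Lemma sol_lsys_nat (Q Z J K K' : finType) (d : Q -> Z -> Q)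
    (f : J * Q -> tm Th (J * Z + K)%type) (s : K -> tm Th K') x :
  bind (sol (lsys d f) x) s
  = sol (lsys d (fun x => bind (f x)
      (sumcase (fun y => var (inl y)) (fun k => bind (s k) (fun k => var (inr k)))))) x.
Proof.
rewrite sol_nat; apply: eq_sol => y; rewrite /lsys !bindA; apply: eq_bind => -[z|k] /=.
  by rewrite !bindv.
by rewrite bindv /= bindA; apply: eq_bind => k'; rewrite bindv.
Qed.

Lemma eq_sol_lsys (Q Z J K : finType) (d : Q -> Z -> Q)
    (f g : J * Q -> tm Th (J * Z + K)%type) : f =1 g -> sol (lsys d f) =1 sol (lsys d g).
Proof. by move/funext->. Qed.

Lemma VGamma_sub (Q Q' Z : finType) (d : Q -> Z -> Q) (d' : Q' -> Z -> Q') (h : Q' -> Q) :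
  injective h -> (forall q z, h (d' q z) = d (h q) z) -> VGamma d -> VGamma d'.
Proof.
move=> hI hd VQ J K f j q; rewrite -(VQ _ _ f j (h q)).
symmetry; apply: (@sol_sub _ _ _ (fun x : J * Q' => (x.1, h x.2)) _ _ _ _ (j, q)).
  by move=> [j1 q1] [j2 q2] [-> /hI ->].
by move=> [j1 q1]; rewrite /sys /lsys bindA; apply: eq_bind => -[y|k]; rewrite bindv //= hd.
Qed.

Lemma VGamma_rename (Q Z Z' : finType) (d : Q -> Z -> Q) (d' : Q -> Z' -> Q) (r : Z' -> Z) :
  (forall q z, d' q z = d q (r z)) -> VGamma d -> VGamma d'.
Proof.
move=> dr VQ J K f j q.
pose f' j := bind (f j) (sumcase (fun y => var (inl (y.1, r y.2) : J * Z + K)%type)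
                                 (fun k => var (inr k))).
transitivity (sol (sys d f') (j, q)).
  by apply: eq_sol => -[j' q']; rewrite /sys /lsys bindA; apply: eq_bind => -[y|k];
    rewrite bindv //= dr.
rewrite VQ; apply: eq_sol => -[j' q']; rewrite /sys /lsys bindA; apply: eq_bind => -[y|k];
  by rewrite bindv.
Qed.

(** Equations may depend on the state here, so the [Q]-state is first made part of the sort,
    replacing [J] by [J * Q]. The pairs [((j, h n), n)] then form a closed subsystem, and over one
    state the new system is the original one over [Q]. *)
Lemma sol_lsys_hom (N Q Z : finType) (dN : N -> Z -> N) (d : Q -> Z -> Q) (h : N -> Q) :
  (forall n z, h (dN n z) = d (h n) z) -> VGamma dN ->
  forall (J K : finType) (f : J * Q -> tm Th (J * Z + K)%type) j n,
  sol (lsys d f) (j, h n) = sol (lsys dN (fun x => f (x.1, h x.2))) (j, n).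
Proof.
move=> hd VN J K f j n.
pose f' x := bind (f x) (sumcase (fun y => var (inl (y.1, d x.2 y.2, y.2)))
                                 (fun k => var (inr k : (J * Q) * Z + K)%type)).
have := VN _ _ f' (j, h n) n.
rewrite (@sol_sub _ _ _ (fun x : J * N => ((x.1, h x.2), x.2)) (sys dN f')
           (lsys dN (fun x => f (x.1, h x.2))) _ _ (j, n)).
- move=> ->; symmetry.
  apply: (@sol_sub _ _ _ (fun x : J * Q => (x, tt)) _ _ _ _ (j, h n)).
    by move=> x y [].
  by move=> x; rewrite /sys /lsys !bindA; apply: eq_bind => -[y|k]; rewrite !bindv.
- by move=> [? ?] [? ?] [-> _ ->].
by move=> [j' n']; rewrite /sys /lsys !bindA; apply: eq_bind => -[y|k]; rewrite !bindv //= hd.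
Qed.

(** The homomorphism may vary with [q], so unions of images are covered. *)
Lemma VGamma_hom (N Q Z : finType) (dN : N -> Z -> N) (d : Q -> Z -> Q) :
  VGamma dN ->
  (forall q, exists h : N -> Q,
     (forall n z, h (dN n z) = d (h n) z) /\ exists n, h n = q) ->
  VGamma d.
Proof.
move=> VN H J K f j q; have [h [hd [n <-]]] := H q.
by rewrite /sys (sol_lsys_hom hd VN) -(VN _ _ f j n).
Qed.

(** With the [Q2]-state absorbed into the sort, this is a system over [Q1] with letters [Z1];
    collapsing [Q1] leaves the system over [Q2]. *)
Lemma VGamma_cascade (Q1 Z1 Q2 Z : finType) (e1 : Q1 -> Z1 -> Q1) (e2 : Q2 -> Z -> Q2)
    (a : Q2 -> Z -> Z1) : VGamma e1 -> VGamma e2 ->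
  VGamma (fun (q : Q1 * Q2) z => (e1 q.1 (a q.2 z), e2 q.2 z)).
Proof.
move=> V1 V2 J K f j [q1 q2].
pose f' (x : J * Q2) := bind (f x.1)
  (sumcase (fun y => var (inl ((y.1, e2 x.2 y.2), a x.2 y.2) : (J * Q2) * Z1 + K)%type)
           (fun k => var (inr k))).
transitivity (sol (sys e1 f') ((j, q2), q1)).
  symmetry; pose i (x : J * (Q1 * Q2)) := ((x.1, x.2.2), x.2.1).
  apply: (@sol_sub _ _ _ i _ _ _ _ (j, (q1, q2))).
    by move=> [? [? ?]] [? [? ?]] [-> -> ->].
  by move=> [? [? ?]]; rewrite /sys /lsys !bindA; apply: eq_bind => -[y|k]; rewrite !bindv.
rewrite V1 -(V2 _ _ f j q2).
apply: (@sol_sub _ _ _ (fun x : J * Q2 => (x, tt)) _ _ _ _ (j, q2)); first by move=> ? ? [].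
by move=> [? ?]; rewrite /sys /lsys !bindA; apply: eq_bind => -[y|k]; rewrite !bindv.
Qed.

(** An identity letter leads back to the same state, so its occurrences can be eliminated state by
    state. The resulting [g] is the same for every automaton. *)
Lemma VGamma_idletter (Q Z : finType) (d : Q -> Z -> Q) :
  VGamma d -> VGamma (fun q (z : option Z) => if z is Some z then d q z else q).
Proof.
move=> VQ J K f.
pose g := sol (fun j => bind (f j) (sumcase
   (fun y => if y.2 is Some z then var (inr (inl (y.1, z)))
             else var (inl y.1 : J + (J * Z + K))%type)
   (fun k => var (inr (inr k))))).
have E (R : finType) (e : R -> Z -> R) j q :
    sol (sys (fun q (z : option Z) => if z is Some z then e q z else q) f) (j, q)
    = sol (sys e g) (j, q).
  pose L (x : J * R) := bind (f x.1) (sumcase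
   (fun y => if y.2 is Some z then var (inr (inl (y.1, e x.2 z)))
             else var (inl (y.1, x.2) : J * R + (J * R + K))%type)
   (fun k => var (inr (inr k)))).
  rewrite (@bekic_iota _ _ _ id _ L).
    apply: eq_sol => -[j' q'].
    rewrite /sys /lsys /g sol_nat.
    apply: (@sol_sub _ _ _ (fun j => (j, q')) _ _ _ _ j'); first by move=> ? ? [].
    move=> j1; rewrite /L !bindA; apply: eq_bind => -[[y [z|]]|k] /=;
      by rewrite ?bindv /= ?bindv /= ?bindv.
  move=> [j1 q1]; rewrite /sys /lsys /L !bindA; apply: eq_bind => -[[y [z|]]|k] /=;
      by rewrite ?bindv.
move=> j q; rewrite E VQ -E; apply: eq_sol => -[j' q'].
by rewrite /sys /lsys; apply: eq_bind => -[[y [z|]]|k] //=; case: q'.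
Qed.

(** The auxiliary sort [inr (j, z)] stands for [j] with the letter [z] still to be read; eliminating
    it restores the system over pairs. *)
Lemma VGamma_square (Q Z : finType) (d : Q -> Z -> Q) :
  VGamma d -> VGamma (fun q (z : Z * Z) => d (d q z.1) z.2).
Proof.
move=> VQ J K f.
pose f' (x : J + J * Z) : tm Th ((J + J * Z) * Z + K)%type := match x with
  | inl j => bind (f j) (sumcase (fun y => var (inl (inr (y.1, y.2.2), y.2.1)))
                                 (fun k => var (inr k)))
  | inr y => var (inl (inl y.1, y.2)) end.
have E (R : finType) (e : R -> Z -> R) j q :
    sol (sys e f') (inl j, q) = sol (sys (fun q (z : Z * Z) => e (e q z.1) z.2) f) (j, q).
  pose L (x : (J + J * Z) * R) : tm Th ((J + J * Z) * R + (J * R + K))%type :=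
    match x.1 with
    | inl j => bind (f j) (sumcase (fun y => var (inl (inr (y.1, y.2.2), e x.2 y.2.1)))
                                 (fun k => var (inr (inr k))))
    | inr y => var (inr (inl (y.1, e x.2 y.2))) end.
  rewrite (@bekic_iota _ _ _ (fun x : J * R => (inl x.1, x.2)) _ L _ (j, q)).
    apply: eq_sol => -[j' q']; rewrite sol_fix /L /= bindA; apply: eq_bind.
    case=> [[y [z1 z2]]|k] /=; rewrite bindv //=.
    by rewrite sol_fix bindv.
  case=> [[y|y] q'] /=; rewrite /sys /lsys /L /=.
    by rewrite !bindA; apply: eq_bind => -[[y' [z1 z2]]|k] /=; rewrite !bindv.
  by rewrite !bindv.
move=> j q; rewrite -E VQ E; apply: eq_sol => -[j' q'].
by rewrite /sys /lsys; apply: eq_bind => -[].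
Qed.

(* Complete binary trees of depth [n] with optional letters at the leaves; they spell all
   words of length at most [n.+1]. *)
Fixpoint wletter (Z : finType) (n : nat) : finType :=
  match n with 0 => option Z | n'.+1 => (wletter Z n' * wletter Z n')%type end.

Fixpoint wact (Q Z : finType) (d : Q -> Z -> Q) (n : nat) : Q -> wletter Z n -> Q :=
  match n return Q -> wletter Z n -> Q with
  | 0 => fun q z => if z is Some z then d q z else q
  | n'.+1 => fun q z => wact d (wact d q z.1) z.2
  end.

Lemma VGamma_wact (Q Z : finType) (d : Q -> Z -> Q) n : VGamma d -> VGamma (@wact Q Z d n).
Proof.
move=> VQ; elim: n => [|n IHn] /=; first exact: VGamma_idletter.
exact: (VGamma_square IHn).
Qed.

Lemma wactP (Q Z : finType) (d : Q -> Z -> Q) n (u : seq Z) :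
  size u <= n.+1 -> exists z : wletter Z n, forall q, wact d q z = foldl d q u.
Proof.
elim: n u => [|n IHn] [|a u].
- by exists None.
- by case: u => [|? ?] // _; exists (Some a).
- by move=> _; have [//|z zE] := IHn [::]; exists (z, z) => q; rewrite /= !zE.
move=> szu; have [z zE] := IHn u szu; have [//|y yE] := IHn [:: a].
by exists (y, z) => q; rewrite /= zE yE.
Qed.

Lemma VGamma_words (Q Z W : finType) (d : Q -> Z -> Q) (w : W -> seq Z) :
  VGamma d -> VGamma (fun q x => foldl d q (w x)).
Proof.
move=> VQ; pose n := \max_(x : W) size (w x).
have H x : exists z : wletter Z n, forall q, wact d q z = foldl d q (w x).
  by apply: wactP; apply: leq_trans (leqnSn _); apply: (leq_bigmax x).
have [r rE] := choice H.
by apply: (@VGamma_rename _ _ _ (@wact Q Z d n) _ r) => [q x|]; [rewrite rE | apply: VGamma_wact].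
Qed.

(** A direct product is a cascade in which both factors read the same letter. *)
Lemma VGamma_ffun_ord (Q Z : finType) (d : Q -> Z -> Q) n :
  VGamma d -> VGamma (fun (t : {ffun 'I_n -> Q}) z => [ffun i => d (t i) z]).
Proof.
move=> VQ; elim: n => [|n IHn].
  apply: (@VGamma_sub _ _ _ (@act1 Z) _ (fun=> tt)) => //; last exact: VGamma_unit.
  by move=> s t _; apply/ffunP => -[].
apply: (VGamma_hom (VGamma_cascade (fun _ z => z) VQ IHn)) => t.
exists (fun x : Q * {ffun 'I_n -> Q} =>
          [ffun i : 'I_n.+1 => if unlift ord0 i is Some j then x.2 j else x.1]); split.
  move=> [q s] z; apply/ffunP => i; rewrite !ffunE /=.
  by case: unlift => [j|] //; rewrite ffunE.
exists (t ord0, [ffun i => t (lift ord0 i)]); apply/ffunP => i; rewrite ffunE.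
by case: unliftP => [j ->|->] //=; rewrite ffunE.
Qed.

Lemma VGamma_ffun (P Q Z : finType) (d : Q -> Z -> Q) :
  VGamma d -> VGamma (fun (t : {ffun P -> Q}) z => [ffun p => d (t p) z]).
Proof.
move=> VQ; apply: (VGamma_hom (VGamma_ffun_ord (n := #|P|) VQ)) => t.
exists (fun s : {ffun 'I_#|P| -> Q} => [ffun p => s (enum_rank p)]); split.
  by move=> s z; apply/ffunP => p; rewrite !ffunE.
by exists [ffun i => t (enum_val i)]; apply/ffunP => p; rewrite !ffunE enum_rankK.
Qed.

(** In the application [N] is the transformation monoid generated by [B], and [P] is the image of
    [c] with inclusion [v]. Between two uses of [c] an element [n] of [N] acts, and [n] followed by
    [c] is a letter of the automaton on [P]. *)
Lemma VGamma_local_divisor (Q B N P : finType) (d : Q -> B -> Q) (c : Q -> Q)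
    (nu : N -> B -> N) (n1 : N) (e : N -> Q -> Q) (v : P -> Q) (cp : Q -> P) :
  (forall q, e n1 q = q) -> (forall n b q, e (nu n b) q = d (e n q) b) ->
  (forall q, v (cp q) = c q) ->
  VGamma d -> VGamma nu -> VGamma (fun p n => cp (e n (v p))) ->
  VGamma (fun q (z : option B) => if z is Some b then d q b else c q).
Proof.
move=> e1 eS vcp VQ VN VP J K f.
(* The parameter [(j, n)] records that [c] is read at [n]; hence [g] has letters [N] and can serve
   as right-hand side over [P]. *)
pose fN (x : J * N) : tm Th (J * B + (J * N + K))%type := bind (f x.1) (sumcase
   (fun y => if y.2 is Some b then var (inl (y.1, b)) else var (inr (inl (y.1, x.2))))
   (fun k => var (inr (inr k)))).
pose g j := sol (lsys nu fN) (j, n1).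
pose t := sol (sys (@act1 N) g).
(* [t] does not depend on [Q], so the claim is this one for [Q] and for [unit]. *)
suff E (R P' : finType) (dR : R -> B -> R) (cR : R -> R) (eR : N -> R -> R) (vR : P' -> R)
    (cpR : R -> P') : (forall q, eR n1 q = q) ->
    (forall n b q, eR (nu n b) q = dR (eR n q) b) ->
    (forall q, vR (cpR q) = cR q) -> VGamma dR -> VGamma (fun p n => cpR (eR n (vR p))) ->
    forall j q, sol (sys (fun q (z : option B) => if z is Some b then dR q b else cR q) f)
      (j, q) = t (j, tt).
  move=> j q; rewrite (E Q P d c e v cp) //.
  have <- : sol (sys (fun q (z : option B) => if z is Some b then @act1 B q b else id q) f)
      (j, tt) = t (j, tt).
    by apply: (E _ _ _ _ (fun _ => id) id id) => //; [move=> n b [] | exact: VGamma_unit..].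
  apply: eq_sol => -[j' q']; rewrite /sys /lsys; apply: eq_bind => -[[y [b|]]|k] //=.
  by case: q'.
move=> eR1 eRS vcpR VR VP' j q.
pose fR (x : J * R) : tm Th (J * B + (J * P' + K))%type := bind (f x.1) (sumcase
   (fun y => if y.2 is Some b then var (inl (y.1, b)) else var (inr (inl (y.1, cpR x.2))))
   (fun k => var (inr (inr k)))).
(* The homomorphism from [n] to [eR n (vR p)] starts at [vR p] and identifies the eliminated system
   with the one given by [g] over [P'], which [VP'] collapses to [t]. *)
have solP j' p : sol (fun x : J * P' => sol (lsys dR fR) (x.1, vR x.2)) (j', p)
               = t (j', tt).
  rewrite /t -(VP' _ _ g j' p); apply: eq_sol => -[{}j' {}p] /=.
  rewrite -{1}[vR p]eR1.
  rewrite (@sol_lsys_hom N R B nu dR (fun n => eR n (vR p))) //.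
  rewrite /sys {2}/lsys /= /g sol_lsys_nat; apply: eq_sol_lsys => -[j1 n].
  rewrite /fR /fN /= bindA; apply: eq_bind => -[[y [b|]]|k] /=;
    by rewrite bindv //= bindv.
rewrite (@bekic _ _ _ (fun x : J * P' => (x.1, vR x.2)) _ (lsys dR fR)); last first.
  move=> [j' q']; rewrite /sys /lsys /fR !bindA; apply: eq_bind => -[[y [b|]]|k] /=;
    by rewrite !bindv /= ?vcpR ?bindv //= vcpR.
(* All values at [P'] agree, so the parameters can forget where [c] is read. By [VN], [t] solves the
   forgetful system, and [VR] transfers it from one state to [q]. *)
pose f0 j : tm Th (J * B + (J * unit + K))%type := bind (f j) (sumcase
   (fun y => if y.2 is Some b then var (inl (y.1, b)) else var (inr (inl (y.1, tt))))
   (fun k => var (inr (inr k)))).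
have tE : t =1 sol (fun x => sol (sys (@act1 B) f0) (x.1, tt)).
  apply: eq_sol => -[j' []]; rewrite -(VN _ _ f0 j' n1).
  rewrite {1}/sys {1}/lsys /= /g sol_lsys_nat; apply: eq_sol_lsys => -[j1 n].
  rewrite /fN /f0 /= bindA; apply: eq_bind => -[[y [b|]]|k] /=;
    by rewrite bindv //= bindv.
rewrite tE [RHS]sol_fix /= -[in RHS](VR _ _ f0 j q) !sol_lsys_nat.
apply: eq_sol_lsys => -[j1 q1] /=.
rewrite /fR /f0 !bindA; apply: eq_bind => -[[y [b|]]|k] /=; rewrite !bindv //=.
by rewrite solP -tE.
Qed.

End Systems.

(** * The Conway theory of a Conway category *)

Section Powers.
Variables (c : cartCat) (A : ob c).
Implicit Types I J K : finType.

Lemma comp_pair (X Y B D : ob c) (f : hom Y B) (g : hom Y D) (h : hom X Y) :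
  comp (pair f g) h = pair (comp f h) (comp g h).
Proof. by rewrite -[LHS]pair_uniq !compA pi1_pair pi2_pair. Qed.

Lemma pair_ext (X B D : ob c) (f g : hom X (prod B D)) :
  comp (pi1 B D) f = comp (pi1 B D) g -> comp (pi2 B D) f = comp (pi2 B D) g -> f = g.
Proof. by move=> e1 e2; rewrite -[f]pair_uniq -[g]pair_uniq e1 e2. Qed.

Lemma pair_pi (B D : ob c) : pair (pi1 B D) (pi2 B D) = idm (prod B D).
Proof. by apply: pair_ext; rewrite compm1 ?pi1_pair ?pi2_pair. Qed.

Lemma prj_tup (X : ob c) n (f : 'I_n -> hom X A) i : comp (prj A i) (tup f) = f i.
Proof.
elim: n f i => [|n IHn] f i /=; first by case: i.
case: unliftP => [j ->|->]; last by rewrite pi1_pair.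
by rewrite -compA pi2_pair IHn.
Qed.

Lemma prj_ext (X : ob c) n (g h : hom X (pw A n)) :
  (forall i, comp (prj A i) g = comp (prj A i) h) -> g = h.
Proof.
elim: n g h => [|n IHn] g h E; first by rewrite (bang_uniq _ _ g) (bang_uniq _ _ h).
apply: pair_ext; first by have := E ord0; rewrite /= unlift_none.
by apply: IHn => i; have := E (lift ord0 i); rewrite /= liftK -!compA.
Qed.

Definition fpow I : ob c := pw A #|I|.
Definition fprj I (i : I) : hom (fpow I) A := prj A (enum_rank i).
Definition ftup (X : ob c) I (f : I -> hom X A) : hom X (fpow I) :=
  tup (fun k => f (enum_val k)).

Lemma fprj_ftup (X : ob c) I (f : I -> hom X A) i : comp (fprj i) (ftup f) = f i.
Proof. by rewrite /fprj /ftup prj_tup enum_rankK. Qed.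

Lemma fprj_ext (X : ob c) I (g h : hom X (fpow I)) :
  (forall i, comp (fprj i) g = comp (fprj i) h) -> g = h.
Proof. by move=> E; apply: prj_ext => k; rewrite -(enum_valK k); apply: E. Qed.

Lemma comp_ftup (X Y : ob c) I (f : I -> hom Y A) (g : hom X Y) :
  comp (ftup f) g = ftup (fun i => comp (f i) g).
Proof. by apply: fprj_ext => i; rewrite compA !fprj_ftup. Qed.

Lemma eq_ftup (X : ob c) I (f g : I -> hom X A) : f =1 g -> ftup f = ftup g.
Proof. by move/funext->. Qed.

Lemma ftup_fprj (X : ob c) I (h : hom X (fpow I)) : ftup (fun i => comp (fprj i) h) = h.
Proof. by apply: fprj_ext => i; rewrite fprj_ftup. Qed.
End Powers.

Section Theory.
Variables (c : conwayCat) (A D : ob c).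
Implicit Types I J K : finType.

Definition ctm I := hom (prod (fpow A I) D) A.
Definition cvar I (i : I) : ctm I := comp (fprj A i) (pi1 _ _).
Definition cbind I J (t : ctm I) (s : I -> ctm J) : ctm J := comp t (pair (ftup s) (pi2 _ _)).

Definition fjoin I K : hom (prod (fpow A I) (prod (fpow A K) D)) (prod (fpow A (I + K)%type) D) :=
  pair (ftup (sumcase (fun i => comp (fprj A i) (pi1 _ _))
                      (fun k => comp (fprj A k) (comp (pi1 _ _) (pi2 _ _)))))
       (comp (pi2 _ _) (pi2 _ _)).

(** The dagger has parameter object [A^K x D], with [D] as fixed constants; [fjoin] regroups its
    arguments into [A^(I+K) x D]. *)
Definition csol I K (F : I -> ctm (I + K)%type) (i : I) : ctm K :=
  comp (fprj A i) (dag (ftup (fun i => comp (F i) (fjoin I K)))).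

Lemma cbindA I J K (t : ctm I) (s : I -> ctm J) (r : J -> ctm K) :
  cbind (cbind t s) r = cbind t (fun i => cbind (s i) r).
Proof.
by rewrite /cbind -compA; congr comp; rewrite comp_pair pi2_pair comp_ftup.
Qed.

Lemma cbindv I J (i : I) (s : I -> ctm J) : cbind (cvar i) s = s i.
Proof. by rewrite /cbind /cvar -compA pi1_pair fprj_ftup. Qed.

Lemma cbind_var I (t : ctm I) : cbind t (@cvar I) = t.
Proof.
rewrite /cbind -[RHS]compm1; congr comp; apply: pair_ext; last by rewrite pi2_pair compm1.
by rewrite pi1_pair ftup_fprj compm1.
Qed.

(** Common regrouping step for the three Conway laws: a substitution defined by cases becomes
    [fjoin] of the tuples [g1] and [g2]. *)
Lemma cbind_join I J K (X : ob c) (t : ctm (I + K)%type) (s : (I + K)%type -> ctm J)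
    (g : hom X (prod (fpow A J) D)) (g1 : hom X (fpow A I)) (g2 : hom X (fpow A K)) :
  (forall i, comp (s (inl i)) g = comp (fprj A i) g1) ->
  (forall k, comp (s (inr k)) g = comp (fprj A k) g2) ->
  comp (cbind t s) g
  = comp t (comp (fjoin I K) (pair g1 (pair g2 (comp (pi2 _ _) g)))).
Proof.
move=> s1 s2; rewrite /cbind -compA; congr comp.
rewrite !comp_pair !comp_ftup -!compA !pi2_pair; congr pair.
apply: eq_ftup => -[i|k] /=; rewrite ?s1 ?s2 -!compA ?pi1_pair // pi2_pair pi1_pair //.
Qed.

Lemma pair3_eta I K (X : ob c) (h : hom X (prod (fpow A I) (prod (fpow A K) D))) g1 g2 g3 :
  comp (pi1 _ _) h = g1 -> comp (pi1 _ _) (comp (pi2 _ _) h) = g2 ->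
  comp (pi2 _ _) (comp (pi2 _ _) h) = g3 -> pair g1 (pair g2 g3) = h.
Proof.
move=> <- <- <-; rewrite pair_uniq.
by rewrite pair_uniq.
Qed.

Lemma csol_nat I K K' (F : I -> ctm (I + K)%type) (s : K -> ctm K') i :
  cbind (csol F i) s
  = csol (fun i => cbind (F i) (sumcase (fun i => cvar (inl i : I + K'))
                     (fun k => cbind (s k) (fun k => cvar (inr k : I + K'))))) i.
Proof.
rewrite /csol {1}/cbind -compA -dag_param; congr (comp _ (dag _)).
rewrite comp_ftup; apply: eq_ftup => {}i.
rewrite (@cbind_join _ _ _ _ _ _ _ (pi1 _ _) (comp (ftup s) (pi2 _ _))).
- rewrite -compA; congr (comp _ (comp _ _)); symmetry; apply: pair3_eta.
  + by rewrite /mprod pi1_pair comp1m.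
  + by rewrite /mprod pi2_pair compA pi1_pair.
  + by rewrite /mprod pi2_pair compA !pi2_pair.
- by move=> i' /=; rewrite /cvar /fjoin -compA pi1_pair fprj_ftup.
move=> k /=; rewrite /cbind -compA [RHS]compA fprj_ftup.
congr comp; rewrite comp_pair pi2_pair comp_ftup; apply: pair_ext.
  rewrite pi1_pair; apply: fprj_ext => k'.
  by rewrite fprj_ftup /cvar /fjoin -compA pi1_pair fprj_ftup.
by rewrite pi2_pair.
Qed.

Lemma csol_sol I K (F : I -> ctm (I + (I + K))%type) i :
  csol (csol F) i = csol (fun i => cbind (F i) (sumcase (fun i => cvar (inl i : I + K))
                                                        (@cvar (I + K)%type))) i.
Proof.
rewrite /csol; congr comp.
(* The inner solutions form one dagger precomposed with [fjoin]; [dag_param] moves [fjoin] inside,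
   so that [dag_dag] applies. *)
rewrite -(comp_ftup (fun i => comp (fprj A i) _)) ftup_fprj -dag_param dag_dag.
congr dag; rewrite comp_ftup comp_ftup; apply: eq_ftup => {}i.
rewrite (@cbind_join _ _ _ _ _ _ _ (pi1 _ _) (ftup (fun x => comp (cvar x) (fjoin I K)))).
- rewrite -!compA; congr (comp _ (comp _ _)); symmetry; apply: pair3_eta.
  + by rewrite compA /mprod pi1_pair comp1m pi1_pair.
  + rewrite (compA _ _ _ _ _ (pi2 _ _)) /mprod pi2_pair -compA pi2_pair pair_pi compm1.
    rewrite /fjoin pi1_pair; apply: eq_ftup => x.
    by rewrite /cvar -compA pi1_pair fprj_ftup.
  + by rewrite (compA _ _ _ _ _ (pi2 _ _) (mprod _ _)) /mprod pi2_pair -compA pi2_pair pair_pi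
       compm1.
- by move=> i' /=; rewrite /cvar /fjoin -compA pi1_pair fprj_ftup.
by move=> x /=; rewrite fprj_ftup.
Qed.

Lemma csol_comp I J K (F : I -> ctm (J + K)%type) (G : J -> ctm (I + K)%type) i :
  csol (fun i => cbind (F i) (sumcase G (fun k => cvar (inr k : I + K)))) i
  = cbind (F i) (sumcase
          (csol (fun j => cbind (G j) (sumcase F (fun k => cvar (inr k : J + K)))))
          (@cvar K)).
Proof.
have sub (I' J' : finType) (F' : I' -> ctm (J' + K)%type) (G' : J' -> ctm (I' + K)%type) :
  ftup (fun i => comp (cbind (F' i) (sumcase G' (fun k => cvar (inr k : I' + K)))) (fjoin I' K))
  = comp (ftup (fun i => comp (F' i) (fjoin J' K)))
         (pair (ftup (fun j => comp (G' j) (fjoin I' K))) (pi2 _ _)).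
  rewrite comp_ftup; apply: eq_ftup => {}i.
  rewrite (@cbind_join _ _ _ _ _ _ _ (ftup (fun j => comp (G' j) (fjoin I' K)))
     (comp (pi1 _ _) (pi2 _ _))).
  - rewrite -compA; congr (comp _ (comp _ (pair _ _))).
    by rewrite /fjoin pi2_pair pair_uniq.
  - by move=> j /=; rewrite fprj_ftup.
  - by move=> k /=; rewrite /cvar /fjoin -compA pi1_pair fprj_ftup.
rewrite /csol sub dag_comp compA fprj_ftup -compA -sub.
rewrite -[RHS]compm1 (@cbind_join _ _ _ _ _ _ _
  (dag (ftup (fun j => comp (cbind (G j) (sumcase F (fun k => cvar (inr k : J + K)))) (fjoin J K))))
  (pi1 _ _)).
- by rewrite compm1 -[idm _]pair_uniq !compm1.
- by move=> j /=; rewrite compm1.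
by move=> k /=; rewrite compm1.
Qed.

Definition catTheory : conwayTheory :=
  ConwayTheory cbindA cbindv cbind_var csol_nat csol_sol csol_comp.

End Theory.

(** * Translation between [Gamma] in the category and [VGamma] in its theories *)

Section GammaVGamma.
Variable c : conwayCat.

Lemma dag_fix (X D : ob c) (F : hom (prod X D) X) :
  dag F = comp F (pair (dag F) (idm D)).
Proof.
have := dag_comp _ _ _ _ F (pi1 X D).
by rewrite pair_pi compm1 pi1_pair.
Qed.

Lemma dag_retract (X Y D : ob c) (p : hom X Y) (s : hom Y X) (F : hom (prod X D) X) :
  comp s p = idm X -> dag (comp p (comp F (mprod s (idm D)))) = comp p (dag F).
Proof.
move=> sp; rewrite compA /mprod comp1m dag_comp -!compA pi1_pair.
by rewrite (compA _ _ _ _ _ s) sp comp1m -dag_fix.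
Qed.

(** [X] is another presentation of [A^(J * R)], with coordinates [P] and inverse [s]: [(A^J)^n] or
    [A^J] in one direction below, [A^n] or [A] in the other. *)
Lemma sol_sys_dag (A D : ob c) (R Z J K : finType) (d : R -> Z -> R)
    (f : J -> tm (catTheory A D) (J * Z + K)%type) (X : ob c)
    (P : J * R -> hom X A) (s : hom (fpow A (J * R)%type) X)
    (F : hom (prod X (prod (fpow A K) D)) X) :
  (forall x, comp (P x) s = fprj A x) ->
  (forall g h : hom X X, (forall x, comp (P x) g = comp (P x) h) -> g = h) ->
  (forall x, comp (P x) F = comp (f x.1 : ctm A D _) (pair (ftup (sumcase
      (fun y => comp (P (y.1, d x.2 y.2)) (pi1 _ _))
      (fun k => comp (fprj A k) (comp (pi1 _ _) (pi2 _ _))))) (comp (pi2 _ _) (pi2 _ _)))) ->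
  forall x, sol (sys d f) x = comp (P x) (dag F) :> ctm A D K.
Proof.
move=> Ps Pext PF x.
rewrite /= /csol.
have -> : ftup (fun x => comp (sys d f x : ctm A D _) (fjoin A D (J * R)%type K))
        = comp (ftup P) (comp F (mprod s (idm _))).
  rewrite comp_ftup; apply: eq_ftup => {}x.
  rewrite compA PF /sys /lsys /= /cbind -!compA; congr comp.
  rewrite !comp_pair !comp_ftup -!compA !pi2_pair; congr pair.
    apply: eq_ftup => -[y|k] /=.
      by rewrite /cvar -!compA !pi1_pair fprj_ftup /= compA Ps.
    by rewrite /cvar -!compA !pi1_pair fprj_ftup /= pi2_pair comp1m.
  by rewrite comp1m.
rewrite dag_retract; first by rewrite compA fprj_ftup.
by apply: Pext => y; rewrite compA Ps fprj_ftup compm1.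
Qed.

(** [Gamma] is used at the base object [A^J] with parameter object [A^K x D]. *)
Lemma Gamma_imp_VGamma (Q : automaton) (A D : ob c) :
  Gamma c Q -> VGamma (catTheory A D) (@act Q).
Proof.
move=> GQ J K f j q.
pose f' : hom (prod (pw (fpow A J) (nin Q)) (prod (fpow A K) D)) (fpow A J) :=
  ftup (fun j => comp (f j : ctm A D _) (pair (ftup (sumcase
    (fun y : J * 'I_(nin Q) => comp (fprj A y.1) (comp (prj _ y.2) (pi1 _ _)))
    (fun k => comp (fprj A k) (comp (pi1 _ _) (pi2 _ _))))) (comp (pi2 _ _) (pi2 _ _)))).
rewrite (@sol_sys_dag A D _ _ J K _ f _ (fun x => comp (fprj A x.1) (prj _ x.2))
  (tup (fun r => ftup (fun j => fprj A (j, r)))) (fQ f')).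
- rewrite (@sol_sys_dag A D _ _ J K _ f _ (fun x => fprj A x.1)
    (ftup (fun j => fprj A (j, tt))) (comp f' (mprod (diag _ _) (idm _)))).
  + by rewrite GQ /= -compA; congr comp; rewrite compA prj_tup comp1m.
  + by move=> [j' []]; rewrite fprj_ftup.
  + by move=> g h E; apply: fprj_ext => j'; apply: (E (j', tt)).
  + move=> [j' []] /=; rewrite compA fprj_ftup -compA; congr comp.
    rewrite /mprod comp_pair comp_ftup -!compA !pi2_pair comp1m; congr pair.
    apply: eq_ftup => -[y|k] /=; rewrite -!compA ?pi1_pair ?pi2_pair ?comp1m //.
    by rewrite (compA _ _ _ _ _ (prj _ _)) prj_tup comp1m.
- by move=> [j' r]; rewrite -compA prj_tup fprj_ftup.
- move=> g h E; apply: prj_ext => r; apply: fprj_ext => j'.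
  by rewrite !compA; apply: (E (j', r)).
move=> [j' r] /=; rewrite -compA prj_tup compA fprj_ftup -compA; congr comp.
rewrite /mprod comp_pair comp_ftup -!compA !pi2_pair comp1m; congr pair.
apply: eq_ftup => -[y|k] /=; rewrite -!compA ?pi1_pair ?pi2_pair ?comp1m //.
by rewrite (compA _ _ _ _ _ (prj _ _)) prj_tup.
Qed.

Lemma VGamma_imp_Gamma (Q : automaton) :
  (forall A D : ob c, VGamma (catTheory A D) (@act Q)) -> Gamma c Q.
Proof.
move=> VQ A D f.
pose f' (_ : unit) : tm (catTheory A D) (unit * 'I_(nin Q) + void)%type :=
  comp f (pair (tup (fun a => comp (fprj A (inl (tt, a) : unit * 'I_(nin Q) + void)%type)
                        (pi1 _ _))) (pi2 _ D)).
(* The theory carries the empty power [A^void] next to [D]. The section [e] makes the projection to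
   [D] epic, so the extra factor can be cancelled. *)
pose e : hom D (prod (fpow A void) D) := pair (ftup (fun x : void => match x with end)) (idm D).
have e2 (X : ob c) (g h : hom D X) : comp g (pi2 (fpow A void) D) = comp h (pi2 _ _) -> g = h.
  by move/(congr1 (fun m => comp m e)); rewrite -!compA pi2_pair !compm1.
apply: prj_ext => q; rewrite compA prj_tup comp1m; apply: e2.
rewrite -compA -!dag_param.
have := VQ A D _ _ f' tt q.
rewrite (@sol_sys_dag A D _ _ _ _ _ f' _ (fun x => prj A x.2)
  (tup (fun r => fprj A (tt, r))) (comp (fQ f) (mprod (idm _) (pi2 _ _)))).
- rewrite (@sol_sys_dag A D _ _ _ _ _ f' _ (fun x => idm A)
    (fprj A (tt, tt)) (comp (comp f (mprod (diag _ _) (idm _))) (mprod (idm _) (pi2 _ _)))).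
  + by move=> ->; rewrite comp1m.
  + by move=> [[] []]; rewrite comp1m.
  + by move=> g h /(_ (tt, tt)); rewrite !comp1m.
  + move=> [[] []] /=; rewrite comp1m /f' -!compA; congr comp.
    rewrite /mprod !comp_pair -!compA !pi2_pair !comp1m pi1_pair; congr pair.
    apply: prj_ext => a; rewrite !compA !prj_tup comp1m -compA pi1_pair.
    by rewrite fprj_ftup.
- by move=> [[] r]; rewrite prj_tup.
- by move=> g h E; apply: prj_ext => r; apply: (E (tt, r)).
move=> [[] r] /=; rewrite compA prj_tup /f' -!compA; congr comp.
rewrite /mprod !comp_pair -!compA !pi2_pair !comp1m !pi1_pair; congr pair.
by apply: prj_ext => a; rewrite !compA !prj_tup -compA pi1_pair fprj_ftup.
Qed.

End GammaVGamma.

(** * Division and the local divisor induction *)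

Lemma card_inj_lt (X Y : finType) (f : X -> Y) (y : Y) :
  injective f -> (forall x, f x != y) -> #|X| < #|Y|.
Proof.
move=> fI fy; rewrite -(card_codom fI); apply: proper_card; apply/properP; split.
  exact/subsetP.
by exists y => //; apply/codomP => -[x yE]; have := fy x; rewrite yE eqxx.
Qed.

(* [H] is the image of a subsemigroup of the transition monoid: the relation [R u h]
   says that the transformation induced by the word [u] is mapped to [h]. *)
Definition wdiv (Q Z : finType) (d : Q -> Z -> Q) (hT : finGroupType) (H : {group hT}) :=
  exists R : seq Z -> hT -> Prop,
    [/\ forall u g, R u g -> g \in H,
        forall u v g h, R u g -> R v h -> R (u ++ v) (g * h)%g,
        forall u v g h, R u g -> R v h -> (forall q, foldl d q u = foldl d q v) -> g = h &
        forall g, g \in H -> exists u, R u g].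

(** The new relation lives on coded words only; by hypothesis the action of a coded word determines
    that of [u], so it still respects equality of transformations. *)
Lemma wdiv_words (Q Z Q' Z' : finType) (d : Q -> Z -> Q) (d' : Q' -> Z' -> Q')
    (e : Z -> seq Z') :
  (forall u v, (forall q, foldl d' q (flatten (map e u)) = foldl d' q (flatten (map e v))) ->
     forall q, foldl d q u = foldl d q v) ->
  forall (hT : finGroupType) (H : {group hT}), wdiv d H -> wdiv d' H.
Proof.
move=> E hT H [R [RH RM RI RS]].
exists (fun w g => exists2 u, R u g & w = flatten (map e u)); split.
- by move=> w g [u /RH].
- move=> w w' g h [u Ru ->] [v Rv ->]; exists (u ++ v); first exact: RM.
  by rewrite map_cat flatten_cat.
- by move=> w w' g h [u Ru ->] [v Rv ->] /E; apply: RI Rv.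
by move=> g /RS[u Ru]; exists (flatten (map e u)); exists u.
Qed.

Lemma foldl_mulg (gT : finGroupType) (x : gT) u :
  foldl (fun x y : gT => x * y)%g x u = (x * \prod_(y <- u) y)%g.
Proof.
elim: u x => [|y u IHu] x; first by rewrite big_nil mulg1.
by rewrite /= IHu big_cons mulgA.
Qed.

Section Main.
Variable Th : conwayTheory.

Lemma VGamma_grpAutT (gT : finGroupType) :
  VGamma Th (@act (grpAut [set: gT]%G)) -> VGamma Th (fun x y : gT => x * y)%g.
Proof.
set S := [set: gT]%G => V.
pose r x : 'I_#|S| := enum_rank_in (group1 S) x.
have rK x : enum_val (r x) = x by apply: enum_rankK_in; rewrite inE.
have V' : VGamma Th (fun q x => @act (grpAut S) q (r x)) by apply: (VGamma_rename _ V).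
apply: (VGamma_hom V') => x; exists enum_val; split; last by exists (r x).
by move=> i y; rewrite /= rK; rewrite enum_rankK_in ?inE.
Qed.

(** [a] is the Schreier cocycle of the transversal [rp]. It takes values in [N], and [(n, x)] to
    [n * rp x] maps the cascade onto the group. *)
Lemma VGamma_mulg_normal (gT : finGroupType) (N : {group gT}) : (N <| [set: gT])%g ->
  VGamma Th (fun x y : subg_of N => x * y)%g -> VGamma Th (fun x y : coset_of N => x * y)%g ->
  VGamma Th (fun x y : gT => x * y)%g.
Proof.
move=> nN VN VC.
have nrm x : x \in 'N(N)%g by apply: (subsetP (normal_norm nN)); rewrite inE.
have VC' : VGamma Th (fun (x : coset_of N) (g : gT) => x * coset N g)%g.
  exact: (VGamma_rename (r := coset N) _ VC).
pose rp (x : coset_of N) : gT := repr x.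
have rpK x : coset N (rp x) = x by apply: coset_reprK.
pose a x g := subg N (rp x * g * (rp (x * coset N g))^-1)%g.
apply: (VGamma_hom (VGamma_cascade a VN VC')) => y.
exists (fun p : subg_of N * coset_of N => sgval p.1 * rp p.2)%g; split=> [[n x] g|]; last first.
  exists (subg N (y * (rp (coset N y))^-1)%g, coset N y) => /=.
  rewrite subgK ?mulgKV // (coset_idr (nrm _)) // morphM ?morphV ?nrm //=.
  by rewrite rpK mulgV.
rewrite /= subgK; last first.
  rewrite (coset_idr (nrm _)) // !morphM ?morphV ?nrm //= !rpK.
  by rewrite mulgV.
by rewrite -!mulgA mulVg mulg1.
Qed.

Lemma VGamma_mulg (gT : finGroupType) :
  (forall (hT : finGroupType) (H : {group hT}), simple H ->
     wdiv (fun x y : gT => x * y)%g H -> VGamma Th (@act (grpAut H))) ->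
  VGamma Th (fun x y : gT => x * y)%g.
Proof.
have [n] := ubnP #|gT|; elim: n gT => // n IHn gT /ltnSE-len Hs.
have [T1|T1] := eqVneq [set: gT] 1%g.
  apply: (@VGamma_sub _ _ _ _ (@act1 gT) _ (fun=> tt)) => //; last exact: VGamma_unit.
  move=> x y _; have: x \in [set: gT] by rewrite inE.
  have: y \in [set: gT] by rewrite inE.
  by rewrite T1 !inE => /eqP-> /eqP->.
have [Sim|nS] := boolP (simple [set: gT]).
  apply: VGamma_grpAutT; apply: Hs => //.
  (* A simple group divides its own automaton: a word maps to its product, which is recovered from
     its action on 1. *)
  exists (fun u g => (\prod_(y <- u) y)%g = g); split.
  - by move=> u g _; rewrite inE.
  - by move=> u v _ _ <- <-; rewrite big_cat.
  - by move=> u v _ _ <- <- /(_ 1%g); rewrite !foldl_mulg !mul1g.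
  - by move=> g _; exists [:: g]; rewrite big_seq1.
have [N [nN N1 NT]] : exists N : {group gT}, [/\ (N <| [set: gT])%g, N :!=: 1%g & N :!=: [set: gT]].
  apply: contrapT => nE; move/negP: nS; apply; apply/simpleP; split=> // N nN.
  have [->|N1] := eqVneq (N : {set gT}) 1%g; first by left.
  have [->|NT] := eqVneq (N : {set gT}) [set: gT]; first by right.
  by case: nE; exists N.
have nrm x : x \in 'N(N)%g by apply: (subsetP (normal_norm nN)); rewrite inE.
apply: (VGamma_mulg_normal nN); apply: IHn.
- have [y yN] : exists y, y \notin N.
    apply: contrapT => nE; move/eqP: NT; apply; apply/setP => y; rewrite inE.
    by apply: contrapT => /negP yN; apply: nE; exists y.
  apply: leq_trans len; apply: (@card_inj_lt _ _ (@sgval _ N) y); first exact: subg_inj.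
  by move=> x; apply: contraNneq yN => <-; apply: subgP.
- move=> hT H sH dH; apply: Hs => //; apply: (wdiv_words (e := fun x => [:: sgval x]) _ dH).
  have E (x : subg_of N) u : sgval (foldl (fun x y => x * y)%g x u)
      = foldl (fun x y => x * y)%g (sgval x) (flatten [seq [:: sgval y] | y <- u]).
    by elim: u x => //= y u IHu x; rewrite IHu.
  by move=> u v uv x; apply: subg_inj; rewrite !E.
(* The quotient is smaller: a nontrivial element of [N] is never a chosen representative, since the
   trivial coset is represented by 1. *)
- have /trivgPn[y yN y1] := N1.
  apply: leq_trans len; apply: (@card_inj_lt _ _ (fun x : coset_of N => repr x) y).
    by move=> x x' xx; rewrite -[x]coset_reprK xx coset_reprK.
  move=> x; apply: contraNneq y1 => xy; rewrite -xy.
  by rewrite -[x]coset_reprK xy coset_id // repr_coset1.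
move=> hT H sH dH; apply: Hs => //.
apply: (wdiv_words (e := fun x : coset_of N => [:: repr x]) _ dH).
have E (x : gT) u : coset N (foldl (fun x y => x * y)%g x
     (flatten [seq [:: repr (y : coset_of N)] | y <- u]))
    = foldl (fun x y => x * y)%g (coset N x) u.
  by elim: u x => //= y u IHu x; rewrite IHu morphM ?nrm //= coset_reprK.
by move=> u v uv x; rewrite -[x]coset_reprK -!E uv.
Qed.

(** The permutations induced by words form a finite group, and [Q] is the union of its orbits, each
    an image of the regular automaton. *)
Lemma VGamma_perm (Q Z : finType) (d : Q -> Z -> Q) : (forall z, injective (d^~ z)) ->
  (forall (hT : finGroupType) (H : {group hT}), simple H ->
     wdiv d H -> VGamma Th (@act (grpAut H))) -> VGamma Th d.
Proof.
move=> dI Hs.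
pose W := [set g : {perm Q} | `[< exists u, forall q, foldl d q u = g q >]].
have WP (g : {perm Q}) : reflect (exists u, forall q, foldl d q u = g q) (g \in W).
  by rewrite inE; apply: asboolP.
have gW : group_set W.
  apply/group_setP; split; first by apply/WP; exists [::] => q; rewrite perm1.
  move=> g h /WP[u uE] /WP[v vE]; apply/WP; exists (u ++ v) => q.
  by rewrite foldl_cat uE vE permM.
pose G := Group gW.
have pG z : perm (dI z) \in G by apply/WP; exists [:: z] => q /=; rewrite permE.
have [e eE] : {e : subg_of G -> seq Z & forall g q, foldl d q (e g) = sgval g q}.
  apply: (@choice _ _ (fun (g : subg_of G) u => forall q, foldl d q u = sgval g q)) => g.
  exact/WP/subgP.
have V : VGamma Th (fun x y : subg_of G => x * y)%g.
  apply: VGamma_mulg => hT H sH dH; apply: Hs => //; apply: (wdiv_words (e := e) _ dH).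
  have E g u q : sgval (foldl (fun x y : subg_of G => x * y)%g g u) q
     = foldl d (sgval g q) (flatten (map e u)).
    elim: u g => //= x u IHu g; rewrite IHu foldl_cat eE.
    by rewrite /= permM.
  by move=> u v uv g; apply: subg_inj; apply/permP => q; rewrite !E.
have V' : VGamma Th (fun (g : subg_of G) z => g * subg G (perm (dI z)))%g.
  exact: (VGamma_rename (r := fun z => subg G (perm (dI z))) _ V).
apply: (VGamma_hom V') => q; exists (fun g : subg_of G => sgval g q); split.
  by move=> g z /=; rewrite permM subgK // permE.
by exists 1%g; rewrite /= perm1.
Qed.

Lemma VGamma_simple_divisors (Q Z : finType) (d : Q -> Z -> Q) :
  (forall (hT : finGroupType) (H : {group hT}), simple H ->
     wdiv d H -> VGamma Th (@act (grpAut H))) -> VGamma Th d.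
Proof.
have [n] := ubnP #|Q|; elim: n Q Z d => // n IHn Q Z d /ltnSE-len.
have [m] := ubnP #|Z|; elim: m Z d => // m IHm Z d /ltnSE-lem Hs.
have [dI|] := pselect (forall z, injective (d^~ z)); first exact: VGamma_perm.
move/existsNP=> [c cI].
pose B : finType := {z : Z | z != c}; pose dB q (b : B) := d q (val b).
have VB : VGamma Th dB.
  apply: IHm => [|hT H sH dH].
    by apply: leq_trans lem; apply: (@card_inj_lt B Z val c val_inj) => b; apply: (valP b).
  apply: Hs => //; apply: (wdiv_words (e := fun b => [:: val b]) _ dH).
  have E u q : foldl d q (flatten [seq [:: val b] | b : B <- u]) = foldl dB q u.
    by elim: u q => /=.
  by move=> u v uv q; rewrite -!E.
(* [N] consists of the transformations induced by words over [B], a subautomaton of the power of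
   [dB] indexed by [Q]. *)
pose T : finType := {ffun Q -> Q}.
pose inN (t : T) := `[< exists u, forall q, foldl dB q u = t q >].
pose N : finType := {t : T | inN t}.
have NP t (b : B) : inN t -> inN [ffun q => dB (t q) b].
  move=> /asboolP[u uE]; apply/asboolP; exists (rcons u b) => q.
  by rewrite foldl_rcons uE ffunE.
pose nu (t : N) b : N := Sub _ (NP (val t) b (valP t)).
have VN : VGamma Th nu.
  apply: (@VGamma_sub _ _ _ _ (fun (t : T) b => [ffun q => dB (t q) b]) _ val) => //.
    exact: val_inj.
  exact: VGamma_ffun.
have N1 : inN [ffun q => q].
  by apply/asboolP; exists [::] => q; rewrite ffunE.
pose n1 : N := Sub _ N1.
have [w wE] : {w : N -> seq B & forall t q, foldl dB q (w t) = val t q}.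
  apply: (@choice _ _ (fun (t : N) u => forall q, foldl dB q u = val t q)) => t.
  exact/asboolP/(valP t).
pose P : finType := {q : Q | q \in codom (d^~ c)}.
pose cp q : P := exist _ (d q c) (codom_f (d^~ c) q).
(* The image of [c] is smaller than [Q] because [c] is not injective. The letter [t] is realised in
   [Q] by the word [w t] followed by [c]. *)
have VP : VGamma Th (fun (p : P) (t : N) => cp (val t (val p))).
  apply: IHn => [|hT H sH dH].
    apply: leq_trans len; rewrite card_sig.
    rewrite ltn_neqAle (leq_image_card (d^~ c) Q) andbT.
    by apply/negP => /image_injP iI; apply: cI => x y; apply: iI.
  apply: Hs => //.
  apply: (wdiv_words (e := fun t => rcons (map val (w t)) c) _ dH).
  have E u (p : P) : foldl d (val p) (flatten [seq rcons (map val (w t)) c | t : N <- u])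
      = val (foldl (fun (p : P) (t : N) => cp (val t (val p))) p u).
    elim: u p => //= t u IHu p; rewrite foldl_cat foldl_rcons -IHu /=; congr foldl.
    congr d; rewrite -wE; elim: (w t) (val p) => //= b s IHs q.
  by move=> u v uv p; apply: val_inj; rewrite -!E.
have V : VGamma Th (fun q (z : option B) => if z is Some b then dB q b else d q c).
  apply: (@VGamma_local_divisor _ _ _ N P _ _ nu n1 (fun t q => val t q) val cp) => //.
    by move=> q /=; rewrite ffunE.
  by move=> t b q /=; rewrite ffunE.
apply: (VGamma_rename (r := fun z => insub z : option B) _ V) => q z.
by case: insubP => [b _ <-|/negPn/eqP ->].
Qed.

End Main.

(* A minimal subsemigroup [S] still mapping onto the group satisfies [tS = S = St] for
   all [t] in [S], hence is itself a group. *)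
Lemma wdiv_divides (Q : automaton) (hT : finGroupType) (H : {group hT}) :
  wdiv (@act Q) H -> divides H Q.
Proof.
case=> R [RH RM RI RS].
pose r (t : trans Q) g := exists2 u, R u g & forall q, t q = act_word q u.
have rH t g : r t g -> g \in H by case=> u /RH.
have rM s t g h : r s g -> r t h -> r (tmul s t) (g * h)%g.
  move=> [u Ru uE] [v Rv vE]; exists (u ++ v); first exact: RM.
  by move=> q; rewrite ffunE uE vE /act_word foldl_cat.
have rI t g h : r t g -> r t h -> g = h.
  move=> [u Ru uE] [v Rv vE]; apply: (RI _ _ _ _ Ru Rv) => q.
  by rewrite -[LHS]uE -[RHS]vE.
have mA (s t w : trans Q) : tmul s (tmul t w) = tmul (tmul s t) w.
  by apply/ffunP => q; rewrite !ffunE.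
pose good (S : {set trans Q}) := [/\ forall s, s \in S -> exists g, r s g,
   forall s t, s \in S -> t \in S -> tmul s t \in S &
   forall g, g \in H -> exists2 s, s \in S & r s g].
have [S minS] : {S | minset (fun S => `[< good S >]) S}.
  apply: ex_minset; exists [set t | `[< exists g, r t g >]]; apply/asboolP; split.
  - by move=> s; rewrite inE => /asboolP.
  - move=> s t; rewrite !inE => /asboolP[g sg] /asboolP[h th].
    by apply/asboolP; exists (g * h)%g; apply: rM.
  - move=> g /RS[u Ru]; have rg : r [ffun q => act_word q u] g.
      by exists u => // q; rewrite ffunE.
    by exists [ffun q => act_word q u] => //; rewrite inE; apply/asboolP; exists g.
have /asboolP[SR SM SS] := minsetp minS.
(* If [t] lies over [h], multiplying it by an [s] over [h^-1 * g] gives an element over [g];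
   minimality then forces equality. *)
have SL t : t \in S -> [set tmul t s | s in S] = S.
  move=> tS; apply: (minsetinf minS); last first.
    by apply/subsetP => _ /imsetP[s sS ->]; apply: SM.
  apply/asboolP; split.
  - by move=> _ /imsetP[s sS ->]; apply: SR; apply: SM.
  - move=> _ _ /imsetP[s sS ->] /imsetP[s' sS' ->]; rewrite -mA.
    by apply: imset_f; apply: (SM _ _ sS); apply: SM.
  - move=> g gH; have [h th] := SR t tS.
    have [|s sS sg] := SS (h^-1 * g)%g; first by rewrite groupM ?groupV ?(rH _ _ th).
    by exists (tmul t s); [apply: imset_f | rewrite -[g](mulKVg h); apply: rM].
have SRt t : t \in S -> [set tmul s t | s in S] = S.
  move=> tS; apply: (minsetinf minS); last first.
    by apply/subsetP => _ /imsetP[s sS ->]; apply: SM.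
  apply/asboolP; split.
  - by move=> _ /imsetP[s sS ->]; apply: SR; apply: SM.
  - move=> _ _ /imsetP[s sS ->] /imsetP[s' sS' ->]; rewrite mA.
    by apply: imset_f; apply: (SM _ _ _ sS'); apply: SM.
  - move=> g gH; have [h th] := SR t tS.
    have [|s sS sg] := SS (g * h^-1)%g; first by rewrite groupM ?groupV ?(rH _ _ th).
    by exists (tmul s t); [apply: imset_f | rewrite -[g](mulgKV h); apply: rM].
have [t0 t0S _] := SS 1%g (group1 H).
have dl t s : t \in S -> s \in S -> exists2 x, x \in S & s = tmul t x.
  by move=> tS; rewrite -{1}(SL t tS) => /imsetP[x xS ->]; exists x.
have dr t s : t \in S -> s \in S -> exists2 x, x \in S & s = tmul x t.
  by move=> tS; rewrite -{1}(SRt t tS) => /imsetP[x xS ->]; exists x.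
(* Every element is some [x t0] and some [t0 x], so [e] is a right and [e'] a left identity on all
   of [S]. *)
have [e eS eE] := dl t0 t0 t0S t0S; have [e' eS' eE'] := dr t0 t0 t0S t0S.
have se s : s \in S -> tmul s e = s.
  by move=> sS; have [x xS ->] := dr t0 s t0S sS; rewrite -mA -eE.
have es' s : s \in S -> tmul e' s = s.
  by move=> sS; have [x xS ->] := dl t0 s t0S sS; rewrite mA -eE'.
have ee : e' = e by rewrite -(es' e eS) se.
have es s : s \in S -> tmul e s = s by rewrite -ee; apply: es'.
have [phi phiE] : {phi : trans Q -> hT & forall s, s \in S -> r s (phi s)}.
  apply: (@choice _ _ (fun s g => s \in S -> r s g)) => s.
  have [sS|sS] := boolP (s \in S); last by exists 1%g.
  by have [g sg] := SR s sS; exists g.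
exists S; split.
  split=> //.
    by move=> s /SR[g [u _ uE]]; exists u.
  exists e => //; split; first by move=> s sS; rewrite es ?se.
  move=> s sS; have [x xS xE] := dl s e sS eS; have [y yS yE] := dr s e sS eS.
  exists x => //; split=> //.
  suff -> : x = y by [].
  by rewrite -(es x xS) yE -mA -xE se.
exists phi; split.
- by move=> s /phiE /rH.
- by move=> s t sS tS; apply: rI (phiE _ (SM _ _ sS tS)) _; apply: rM; apply: phiE.
- by move=> g /SS[s sS sg]; exists s => //; apply: rI sg; apply: phiE.
Qed.

(** Let the letter [j] act by a word inducing a preimage [s j] of the [j]-th group element. Then [S]
    is a subautomaton of a power of [Q], and [phi] maps it onto the group automaton. *)
Lemma VGamma_divides (Th : conwayTheory) (Q : automaton) (gT : finGroupType) (G : {group gT}) :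
  VGamma Th (@act Q) -> divides G Q -> VGamma Th (@act (grpAut G)).
Proof.
move=> VQ [S [[SM Smul _] [phi [phiG phiM phiS]]]].
have [s sE] : {s : 'I_#|G| -> trans Q & forall j, s j \in S /\ phi (s j) = enum_val j}.
  apply: (@choice _ _ (fun j t => t \in S /\ phi t = enum_val j)) => j.
  by have [t tS tE] := phiS _ (enum_valP j); exists t.
have [w wE] : {w : 'I_#|G| -> seq 'I_(nin Q) & forall j q, s j q = act_word q (w j)}.
  by apply: (@choice _ _ (fun j u => forall q, s j q = act_word q u)) => j;
    apply: SM; case: (sE j).
have V := VGamma_ffun (P := 'I_(nst Q)) (VGamma_words w VQ).
pose X : finType := {t : trans Q | t \in S}.
pose dX (t : X) j : X := exist _ (tmul (val t) (s j)) (Smul _ _ (valP t) (sE j).1).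
have VX : VGamma Th dX.
  apply: (VGamma_sub (h := val) val_inj _ V) => t j.
  by apply/ffunP => q; rewrite !ffunE wE.
apply: (VGamma_hom VX) => i.
exists (fun t : X => enum_rank_in (group1 G) (phi (val t))); split.
  move=> t j /=; rewrite phiM ?(valP t) ?(sE j).1 // (sE j).2; congr enum_rank_in.
  by rewrite enum_rankK_in // phiG ?(valP t).
exists (exist _ (s i) (sE i).1) => /=.
by rewrite (sE i).2 enum_valK_in.
Qed.

Theorem theorem5p1 (Qs : automaton -> Prop) (c : conwayCat) :
  (forall Q : automaton, Qs Q -> Gamma c Q) <->
  (forall (gT : finGroupType) (G : {group gT}),
      simple G -> (exists2 Q : automaton, Qs Q & divides G Q) ->
      Gamma c (grpAut G)).
Proof.
split=> [GQ gT G _ [Q QQ dG]|GG Q QQ]; apply: VGamma_imp_Gamma => A D.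
  by apply: (VGamma_divides _ dG); apply: Gamma_imp_VGamma; apply: GQ.
apply: VGamma_simple_divisors => gT G sG dG; apply: Gamma_imp_VGamma; apply: GG => //.
by exists Q => //; apply: wdiv_divides.
Qed.
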